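(* Let $G=(V,E)$ be a connected graph with at least two vertices and let $X\subseteq V$ be the set of cut vertices of $G$. If $\mathrm{evc}(G)=\mathrm{mvc}(G)$, then for every vertex $v\in V\setminus X$ there is a minimum vertex cover $S_v$ of $G$ such that $X\cup\{v\}\subseteq S_v$.
   Context: All graphs are finite and simple. $\mathrm{mvc}(G)$ denotes the minimum cardinality of a vertex cover of $G$. Eternal vertex cover game: guards are placed on vertices of $G$, at most one guard per vertex; the set of occupied vertices is a configuration. In each round an attacker chooses an edge $uv$; the defender responds by moving guards simultaneously, each guard either staying put or moving to an adjacent vertex, such that at least one guard moves across the attacked edge, and after the move at most one guard is on each vertex; the number of guards never changes. An eternal vertex cover class of $G$ is a family $\mathcal{C}$ of vertex covers of $G$, all of the same cardinality, such that for every configuration $S\in\mathcal{C}$ and every attacked edge, the attack can be defended by a legal move leading to a configuration in $\mathcal{C}$. The eternal vertex cover number $\mathrm{evc}(G)$ is the minimum cardinality of a configuration of an eternal vertex cover class of $G$. *)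

(* Defs.v *)
From mathcomp Require Import all_boot.

Set Implicit Arguments.
Unset Strict Implicit.
Unset Printing Implicit Defensive.

(* A finite simple graph on the vertex type T is a symmetric,
   irreflexive relation e : rel T; both properties are hypotheses of the
   results that use the definitions below. *)

Section Graph.
Variables (T : finType) (e : rel T).

Definition connected_graph : bool := [forall x, forall y, connect e x y].

Definition del_vertex (v : T) : rel T :=
  [rel x y | [&& e x y, x != v & y != v]].

(* For a connected graph: deleting v leaves a disconnected graph. *)
Definition cut_vertex (v : T) : bool :=
  [exists x, exists y,
    [&& x != v, y != v, connect e x y & ~~ connect (del_vertex v) x y]].

Definition cut_vertices : {set T} := [set v | cut_vertex v].

Definition vertex_cover (S : {set T}) : bool :=
  [forall x, forall y, e x y ==> (x \in S) || (y \in S)].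

Lemma vertex_cover_setT : vertex_cover [set: T].
Proof. by apply/forallP => x; apply/forallP => y; rewrite !inE implybT. Qed.

Definition mvc : nat := #|[arg min_(S < [set: T] | vertex_cover S) #|S|]|.

Definition min_vertex_cover (S : {set T}) : bool :=
  vertex_cover S && (#|S| == mvc).

(* f x is the new position of the guard on x \in S; the values of f outside S
   are irrelevant. *)
Definition legal_move (S S' : {set T}) (f : {ffun T -> T}) : bool :=
  [&& [forall x in S, (f x == x) || e x (f x)],
      dinjectiveb f (mem S) & f @: S == S'].

Definition moves_across (S : {set T}) (f : {ffun T -> T}) (u v : T) : bool :=
  ((u \in S) && (f u == v)) || ((v \in S) && (f v == u)).

Definition evc_class (C : {set {set T}}) : bool :=
  [&& [forall S in C, vertex_cover S],
      [forall S in C, forall S' in C, #|S| == #|S'|] &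
      [forall S in C, forall u, forall v, e u v ==>
        [exists S' in C, exists f, legal_move S S' f && moves_across S f u v]]].

Definition evc_config (S : {set T}) : bool :=
  [exists C, evc_class C && (S \in C)].

Definition evc : nat := #|[arg min_(S < [set: T] | evc_config S) #|S|]|.

Hypothesis e_sym : symmetric e.

(* The default value of the minimum defining evc is itself admissible: on a
   fully occupied graph, swap the two guards of the attacked edge. *)
Lemma evc_config_setT : evc_config [set: T].
Proof.
apply/existsP; exists [set [set: T]]; rewrite set11 andbT.
apply/and3P; split.
- by apply/forall_inP => S /set1P ->; exact: vertex_cover_setT.
- by apply/forall_inP => S /set1P ->; apply/forall_inP => S' /set1P ->.
apply/forall_inP => S /set1P ->; apply/forallP => u; apply/forallP => v.
apply/implyP => euv; apply/exists_inP; exists [set: T]; first exact: set11.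
pose f x := if x == u then v else if x == v then u else x.
have fK : involutive f.
  move=> x; rewrite /f; case: (eqVneq x u) => [->|xu].
    by rewrite eqxx; case: eqVneq => [->|].
  by case: (eqVneq x v) => [->|xv]; rewrite ?eqxx // (negPf xu) (negPf xv).
apply/existsP; exists (finfun f); apply/andP; split; last first.
  by rewrite /moves_across !inE !ffunE /f !eqxx.
apply/and3P; split.
- apply/forall_inP => x _; rewrite ffunE /f.
  case: (eqVneq x u) => [->|xu]; first by rewrite euv orbT.
  by case: (eqVneq x v) => [->|xv]; rewrite ?eqxx // e_sym euv orbT.
- by apply/dinjectiveP => x y _ _; rewrite !ffunE; exact: (inv_inj fK).
apply/eqP/setP => y; rewrite inE; apply/imsetP.
by exists (f y); rewrite ?inE // ffunE fK.
Qed.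

End Graph.

(* Main.v *)
Require Import Defs.
From mathcomp Require Import all_boot.

(** If a configuration [S] of a class of minimum vertex covers missed a cut
    vertex [x], let [A] and [B] be the two sides of [x]. Attacking an edge from
    [x] into [A] forces a guard of [A] onto [x], and no guard can enter [A]
    since [x] was empty, so the new cover has fewer guards than [S] on [A].
    The same holds for [B]. Gluing the two new covers along [x] gives a vertex
    cover smaller than [S], a contradiction. So every configuration contains
    all cut vertices, and attacking an edge at [v] yields one that also
    contains [v]. *)

Set Implicit Arguments.
Unset Strict Implicit.
Unset Printing Implicit Defensive.

Section Covers.
Variables (T : finType) (e : rel T).

Lemma vertex_coverP (S : {set T}) :
  reflect (forall x y, e x y -> x \notin S -> y \in S) (vertex_cover e S).
Proof.
apply: (iffP forallP) => [cS x y exy xS | cS x].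
  by have /forallP/(_ y) := cS x; rewrite exy (negPf xS).
apply/forallP => y; apply/implyP => exy.
by case: (boolP (x \in S)) => // /(cS _ _ exy).
Qed.

Lemma mvc_le (S : {set T}) : vertex_cover e S -> mvc e <= #|S|.
Proof.
rewrite /mvc; case: arg_minnP => [|M _ minM]; first exact: vertex_cover_setT.
exact: minM.
Qed.

Lemma evc_configP : symmetric e -> exists2 S, evc_config e S & #|S| = evc e.
Proof.
move=> e_sym; rewrite /evc.
(* The default [[set: T]] of the minimum must itself be a configuration; this is where symmetry
   enters. *)
by case: arg_minnP => [|S eS _]; [exact: evc_config_setT | exists S].
Qed.

Section Class.
Variable C : {set {set T}}.
Hypothesis C_class : evc_class e C.

Lemma evc_class_cover S : S \in C -> vertex_cover e S.
Proof. by case/and3P: C_class => /forall_inP cC _ _; exact: cC. Qed.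

Lemma evc_class_card S S' : S \in C -> S' \in C -> #|S| = #|S'|.
Proof.
case/and3P: C_class => _ /forall_inP cC _ SC S'C.
by apply/eqP; exact: (forall_inP (cC _ SC)).
Qed.

Lemma evc_class_defend S u v : S \in C -> e u v ->
  exists2 S', S' \in C & exists2 f, legal_move e S S' f & moves_across S f u v.
Proof.
case/and3P: C_class => _ _ /forall_inP dC SC euv.
have /forallP/(_ u)/forallP/(_ v)/implyP/(_ euv) := dC _ SC.
by case/exists_inP => S' S'C /existsP[f /andP[? ?]]; exists S' => //; exists f.
Qed.

(** With [u] empty, only the guard on [v] can cross the attacked edge. *)
Lemma evc_class_occupy S u v : S \in C -> e u v -> u \notin S ->
  exists2 S', S' \in C & exists f,
    [/\ legal_move e S S' f, v \in S, f v = u & u \in S'].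
Proof.
move=> SC euv uS; have [S' S'C [f mf]] := evc_class_defend SC euv.
rewrite /moves_across (negPf uS) /= => /andP[vS /eqP fv].
exists S' => //; exists f; split=> //.
by case/and3P: mf => _ _ /eqP <-; rewrite -fv imset_f.
Qed.

(** The last hypothesis makes [x] the only possible entrance to [A]. As [x] is empty, no guard
    enters, while the attack on [x y] pulls the guard of [y] out. *)
Lemma evc_class_drain S x y (A : {set T}) :
    S \in C -> x \notin S -> x \notin A -> y \in A -> e x y ->
    (forall p q, e p q -> q \in A -> p != x -> p \in A) ->
  exists S', [/\ S' \in C, x \in S' & #|S' :&: A| < #|S :&: A|].
Proof.
move=> SC xS xA yA exy Aclosed.
have [S' S'C [f [/and3P[/forall_inP mv _ /eqP fS] yS fy xS']]] :=
  evc_class_occupy SC exy xS.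
exists S'; split=> //.
(* Setting [y] aside gives the strict inequality: the guards ending in [A] all come from
   [(S :&: A) :\ y]. *)
rewrite (cardsD1 y (S :&: A)) inE yS yA add1n ltnS.
apply: (leq_trans (subset_leq_card _) (leq_imset_card f _)).
rewrite -fS; apply/subsetP => z /setIP[/imsetP[s sS ->] fsA].
apply: imset_f; rewrite !inE sS /=; apply/andP; split.
  by apply: contraNneq xA => sy; rewrite -fy -sy.
case/orP: (mv _ sS) => [/eqP <- // | esf].
by apply: Aclosed esf fsA _; apply: contraNneq xS => <-.
Qed.

End Class.

Hypothesis e_sym : symmetric e.

(** Otherwise [A] would be closed under adjacency, and no path could lead from [a] to [b]. *)
Lemma neighbor_in_side x a b (A : {set T}) :
    connect e a b -> a \in A -> b \notin A ->
    (forall p q, e p q -> q \in A -> p != x -> p \in A) ->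
  exists2 y, y \in A & e x y.
Proof.
move=> cab aA bA Aclosed.
have [/exists_inP[y yA exy] | /exists_inPn nA] := boolP [exists y in A, e x y].
  by exists y.
have clA : closed e (mem A).
  apply: intro_closed => [|p q epq pA]; first exact: sym_connect_sym.
  apply: (Aclosed q p _ pA); first by rewrite e_sym.
  by apply: contraTneq epq => ->; rewrite e_sym nA.
by have := closed_connect clA cab; rewrite /= aA (negPf bA).
Qed.

Lemma cut_vertex_sides x : cut_vertex e x ->
  exists A B : {set T}, [/\ A :&: B = set0, A :|: B = [set~ x],
    forall p q, e p q -> q \in A -> p != x -> p \in A,
    forall p q, e p q -> q \in B -> p != x -> p \in B &
    (exists2 y, y \in A & e x y) /\ (exists2 y, y \in B & e x y)].
Proof.
case/existsP=> a /existsP[b /and4P[ax bx cab nab]].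
have d_sym : symmetric (del_vertex e x).
  by move=> p q; rewrite /del_vertex /= e_sym [(p != x) && _]andbC.
(* [A] is the component of [a] once [x] is deleted. [B] is everything else apart from [x], possibly
   several components. *)
pose A := [set z | connect (del_vertex e x) a z].
pose B := [set~ x] :\: A.
(* After the deletion [x] is isolated, so only [x] itself reaches it. *)
have xA : x \notin A.
  rewrite inE (sym_connect_sym d_sym); apply: contra ax.
  by case/connectP=> [[|p s] /=]; [move=> _ -> | rewrite /del_vertex /= eqxx andbF].
have clA p q : e p q -> q \in A -> p != x -> p \in A.
  move=> epq qA px; have qx : q != x by apply: contraNneq xA => <-.
  move: qA; rewrite !inE => aq; apply: connect_trans aq (connect1 _).
  by rewrite /del_vertex /= e_sym epq qx.
have clB p q : e p q -> q \in B -> p != x -> p \in B.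
  move=> epq /setDP[]; rewrite in_setC1 => qx qA px.
  rewrite !in_setD in_setC1 px andbT.
  by apply: contra qA => pA; apply: (clA _ p _ pA qx); rewrite e_sym.
have aA : a \in A by rewrite inE connect0.
have bA : b \notin A by rewrite inE.
exists A, B; split=> //.
- by apply/setP => z; rewrite in_setI in_setD in_set0; case: (z \in A).
- apply/setP => z; rewrite in_setU in_setD in_setC1.
  by case: (boolP (z \in A)) => //= zA; apply/esym; apply: contraNneq xA => <-.
split; first exact: neighbor_in_side cab aA bA clA.
apply: (@neighbor_in_side x b a) clB; first by rewrite (sym_connect_sym e_sym).
  by rewrite in_setD bA in_setC1.
by rewrite in_setD aA.
Qed.

Lemma evc_class_cut_vertex C S x :
  evc_class e C -> S \in C -> #|S| = mvc e -> cut_vertex e x -> x \in S.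
Proof.
move=> C_class SC Smin /cut_vertex_sides[A [B [AB0 ABx clA clB]]].
case=> [[y yA exy] [z zB exz]]; apply: contraT => xS.
have memAB p : (p \in A) || (p \in B) = (p != x) by rewrite -in_setU ABx in_setC1.
have /norP[xA xB] : ~~ ((x \in A) || (x \in B)) by rewrite memAB eqxx.
have [S1 [S1C xS1 ltA]] := evc_class_drain C_class SC xS xA yA exy clA.
have [S2 [S2C xS2 ltB]] := evc_class_drain C_class SC xS xB zB exz clB.
have/vertex_coverP cov1 := evc_class_cover C_class S1C.
have/vertex_coverP cov2 := evc_class_cover C_class S2C.
(* Both attacks start from [S], but [S1] and [S2] may differ. Since [x] lies on neither side, it is
   added separately. *)
pose R := x |: ((S1 :&: A) :|: (S2 :&: B)).
have covR : vertex_cover e R.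
  apply/vertex_coverP => p q epq; rewrite !inE !negb_or !negb_and.
  case/and3P=> px p1 p2; case: eqVneq => //= qx.
  (* An edge avoiding [x] stays within one side, where [R] agrees with [S1] or [S2]. *)
  move: (px); rewrite -memAB => /orP[pA | pB].
    have qA : q \in A by apply: (clA _ p _ pA qx); rewrite e_sym.
    by rewrite pA orbF in p1; rewrite qA (cov1 _ _ epq p1).
  have qB : q \in B by apply: (clB _ p _ pB qx); rewrite e_sym.
  by rewrite pB orbF in p2; rewrite qB (cov2 _ _ epq p2) orbT.
have cardS : #|S| = #|S :&: A| + #|S :&: B|.
  rewrite -cardsUI -setIUr ABx -setIIr AB0 setI0 cards0 addn0.
  rewrite -setDE; congr #|pred_of_set _|; apply/esym/setDidPl.
  by rewrite disjoint_sym disjoints1.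
have cardR : #|R| <= (#|S1 :&: A| + #|S2 :&: B|).+1.
  by rewrite cardsU1 -add1n leq_add ?leq_b1 // cardsU leq_subr.
(* Each side loses at least one guard and [x] costs only one, so [R] would be smaller than the
   minimum cover [S]. *)
have := leq_trans (mvc_le covR) cardR.
rewrite -Smin cardS leqNgt => /negP[].
by rewrite -addnS -addSn leq_add.
Qed.

Lemma connected_graph_neighbor v :
  connected_graph e -> 2 <= #|T| -> exists w, e v w.
Proof.
move=> /forallP/(_ v)/forallP cv; rewrite -cardsT => /card_gt1P[a [b [_ _ ab]]].
have [w wv] : exists w, w != v.
  by case: (eqVneq a v) ab => [-> | av _]; [exists b; rewrite eq_sym | exists a].
have /connectP[[|u s] /=] := cv w; first by move=> _ wE; rewrite wE eqxx in wv.
by case/andP=> evu _ _; exists u.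
Qed.

End Covers.

Theorem theorem1 (T : finType) (e : rel T)
    (e_sym : symmetric e) (e_irr : irreflexive e)
    (e_conn : connected_graph e) (T_ge2 : 2 <= #|T|)
    (evc_mvc : evc e = mvc e) (v : T) :
  v \notin cut_vertices e ->
  exists S : {set T},
    min_vertex_cover e S /\ cut_vertices e :|: [set v] \subset S.
Proof.
move=> _; have [S0 /existsP[C /andP[C_class S0C]] S0min] := evc_configP e_sym.
have [S SC vS] : exists2 S, S \in C & v \in S.
  have [vS0 | vS0] := boolP (v \in S0); first by exists S0.
  have [w evw] := connected_graph_neighbor v e_conn T_ge2.
  have [S SC [f [_ _ _ vS]]] := evc_class_occupy C_class S0C evw vS0.
  by exists S.
(* Configurations of one class have equal size, so minimality passes from [S0] to [S]. *)
have Smin : #|S| = mvc e by rewrite (evc_class_card C_class SC S0C) S0min.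
exists S; split.
  by rewrite /min_vertex_cover (evc_class_cover C_class SC) Smin eqxx.
rewrite subUset sub1set vS andbT; apply/subsetP => x; rewrite inE.
exact: (evc_class_cut_vertex e_sym C_class SC Smin).
Qed.
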